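(* Let $Y$ be a target variable and $X_i$ a feature, jointly continuous. For a mapping $f_i$ of $X_i$, let $q_{\theta_i}(Y\mid f_i(X_i))$ be a surrogate conditional distribution, parameterized by $\theta_i$, for the true conditional distribution $p(Y\mid f_i(X_i))$. Then the following optimization minimizes an upper bound on the non-negative error $I(Y;X_i)-I(Y;f_i(X_i))$: $$\max_{f_i,\theta_i}\ \mathbb{E}\big[\log q_{\theta_i}(Y\mid f_i(X_i))\big],$$ where the expectation is taken over the joint distribution of $Y$ and $X_i$.
   Context: $V=\{X_1,\dots,X_m\}$ is a set of (possibly high-dimensional) features used to predict a target variable $Y$, and $i\in\{1,\dots,m\}$. All variables are assumed jointly continuous. $I(\cdot;\cdot)$ denotes mutual information. $f_i: X_i\mapsto f_i(X_i)$ is a (low-dimensional) mapping of the feature $X_i$. The underlying distributions are unknown; $q_{\theta_i}(Y\mid f_i(X_i))$ serves as a surrogate for $p(Y\mid f_i(X_i))$ and in practice is chosen in a parametric family (for example, a normal distribution whose mean and variance are functions of $f_i(X_i)$ parameterized by neural networks). The error $I(Y;X_i)-I(Y;f_i(X_i))$ is non-negative by the data-processing inequality. *)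

(* Defs.v *)
From HB Require Import structures.
From mathcomp Require Import all_boot all_order all_algebra.
From mathcomp Require Import all_classical all_reals all_analysis.

Set Implicit Arguments.
Unset Strict Implicit.
Unset Printing Implicit Defensive.

Import Order.TTheory GRing.Theory Num.Theory.
Import numFieldNormedType.Exports.

Local Open Scope classical_set_scope.
Local Open Scope ring_scope.

(* R^n is [n.-tuple (measurableTypeR R)], with the product Borel sigma-algebra. *)
Notation "''Rn[' R ]_ n" := (n.-tuple (measurableTypeR R))
  (at level 8, n at level 2, format "''Rn[' R ]_ n") : type_scope.

Section lebesgue_cons.
Local Open Scope ereal_scope.
Context (R : realType) (n : nat).

Definition tuple_cons (p : measurableTypeR R * 'Rn[R]_n) : 'Rn[R]_n.+1 :=
  [the 'Rn[R]_n.+1 of p.1 :: p.2].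

Lemma measurable_tuple_cons : measurable_fun [set: _] tuple_cons.
Proof. exact: measurable_cons. Qed.

Lemma measurable_tuple_uncons : measurable_fun [set: 'Rn[R]_n.+1]
  (fun t => (thead t, [tuple of behead t]) : measurableTypeR R * 'Rn[R]_n).
Proof.
apply: measurable_fun_pair; first exact: measurable_tnth.
exact: measurable_behead.
Qed.

Variable mu : {sigma_finite_measure set 'Rn[R]_n -> \bar R}.

Definition lebesgue_cons : set 'Rn[R]_n.+1 -> \bar R :=
  pushforward ((@lebesgue_measure R) \x mu) tuple_cons.

Let lebesgue_cons0 : lebesgue_cons set0 = 0.
Proof. by rewrite /lebesgue_cons /pushforward preimage_set0 measure0. Qed.

Let lebesgue_cons_ge0 A : 0 <= lebesgue_cons A.
Proof. by rewrite /lebesgue_cons /pushforward; apply: measure_ge0. Qed.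

Let lebesgue_cons_sigma_additive : semi_sigma_additive lebesgue_cons.
Proof.
have mc := measurable_tuple_cons.
move=> F mF tF mUF; rewrite /lebesgue_cons /pushforward preimage_bigcup.
apply: measure_semi_sigma_additive.
- by move=> k; rewrite -[X in measurable X]setTI; exact: mc.
- apply/trivIsetP => /= i j _ _ ij; rewrite -preimage_setI.
  by move/trivIsetP : tF => /(_ _ _ _ _ ij) ->//; rewrite preimage_set0.
- by rewrite -preimage_bigcup -[X in measurable X]setTI; exact: mc.
Qed.

HB.instance Definition _ := isMeasure.Build _ _ _ lebesgue_cons
  lebesgue_cons0 lebesgue_cons_ge0 lebesgue_cons_sigma_additive.

(* Inference on [_ \x _] only finds the sigma-finite instance for products of
   subprobabilities, hence the direct argument. *)
Let lebesgue_cons_sigma_finite : sigma_finite setT lebesgue_cons.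
Proof.
have /sigma_finiteP[F [TF ndF Foo]] := sigma_finiteT (@lebesgue_measure R).
have /sigma_finiteP[G [TG ndG Goo]] := sigma_finiteT mu.
pose u (t : 'Rn[R]_n.+1) : measurableTypeR R * 'Rn[R]_n :=
  (thead t, [tuple of behead t]).
have uK p : u (tuple_cons p) = p.
  by case: p => a s; rewrite /u /tuple_cons theadE; congr pair; apply/val_inj.
exists (fun k => u @^-1` (F k `*` G k)).
  apply/seteqP; split=> // t _.
  have [i _ Fi] : (\bigcup_i F i) (u t).1 by rewrite -TF.
  have [j _ Gj] : (\bigcup_j G j) (u t).2 by rewrite -TG.
  exists (maxn i j) => //; split.
    by move: Fi; exact/subsetPset/ndF/leq_maxl.
  by move: Gj; exact/subsetPset/ndG/leq_maxr.
move=> k; have [mF Fk] := Foo k; have [mG Gk] := Goo k; split.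
  rewrite -[X in measurable X]setTI; apply: measurable_tuple_uncons => //.
  exact: measurableX.
rewrite /lebesgue_cons /pushforward (_ : _ @^-1` _ = F k `*` G k).
  by rewrite product_measure1E// lte_mul_pinfty// ge0_fin_numE.
by apply/seteqP; split=> p; rewrite /preimage /mkset uK.
Qed.

HB.instance Definition _ := Measure_isSigmaFinite.Build _ _ _ lebesgue_cons
  lebesgue_cons_sigma_finite.

End lebesgue_cons.

(* Lebesgue measure on R^n: the n-fold product of the one-dimensional one. *)
Fixpoint lebesgueRn (R : realType) (n : nat) :
    {sigma_finite_measure set 'Rn[R]_n -> \bar R} :=
  match n with
  | 0%N => \d_([tuple] : 'Rn[R]_0)
  | n'.+1 => lebesgue_cons (lebesgueRn R n')
  end.

Section pair_RV.
Context d d1 d2 (T : measurableType d) (T1 : measurableType d1)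
  (T2 : measurableType d2) (f : {mfun T >-> T1}) (g : {mfun T >-> T2}).

Definition pair_RV (w : T) : T1 * T2 := (f w, g w).

Let measurable_pair_RV : measurable_fun [set: T] pair_RV.
Proof. exact: measurable_fun_pair. Qed.

HB.instance Definition _ :=
  isMeasurableFun.Build _ _ _ _ pair_RV measurable_pair_RV.

End pair_RV.

Section information.
Local Open Scope ereal_scope.
Local Open Scope charge_scope.

Definition kl_divergence d (T : measurableType d) (R : realType)
    (mu nu : probability T R) : \bar R :=
  if `[< mu `<< nu >]
  then \int[mu]_x lne (('d (charge_of_finite_measure mu) '/d nu) x)
  else +oo.

Context d (T : measurableType d) (R : realType) (P : probability T R).

(* No density is required of the variables: the mutual information I(Y; f(X))
   has to make sense even when the law of f(X) is singular. *)
Definition mutual_information d1 d2 (T1 : measurableType d1)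
    (T2 : measurableType d2) (Y : {RV P >-> T1}) (X : {RV P >-> T2}) : \bar R :=
  kl_divergence (distribution P (pair_RV Y X))
                (distribution P Y \x distribution P X).

Definition jointly_continuous m n (Y : {RV P >-> 'Rn[R]_m})
    (X : {RV P >-> 'Rn[R]_n}) : Prop :=
  exists p : 'Rn[R]_m * 'Rn[R]_n -> R,
    [/\ measurable_fun [set: _] p,
        forall z, (0 <= p z)%R &
        forall A, measurable A ->
          distribution P (pair_RV Y X) A =
          \int[lebesgueRn R m \x lebesgueRn R n]_(z in A) (p z)%:E].

Definition density m (Y : {RV P >-> 'Rn[R]_m}) : 'Rn[R]_m -> \bar R :=
  'd (charge_of_finite_measure (distribution P Y)) '/d (lebesgueRn R m).

Definition differential_entropy m (Y : {RV P >-> 'Rn[R]_m}) : \bar R :=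
  - \int[distribution P Y]_y lne (density Y y).

(* [q t y] stands for q(y | t). *)
Definition is_conditional_density k m (q : 'Rn[R]_k -> 'Rn[R]_m -> R) : Prop :=
  [/\ measurable_fun [set: 'Rn[R]_k * 'Rn[R]_m] (fun z => q z.1 z.2),
      forall t y, (0 <= q t y)%R &
      forall t, \int[lebesgueRn R m]_y (q t y)%:E = 1].

(* E[log q(Y | f(X))] over the joint law of (Y, X).  Since [lne 0 = -oo], a
   surrogate vanishing with positive probability gets the value [-oo]. *)
Definition expected_log_surrogate m n k (Y : {RV P >-> 'Rn[R]_m})
    (X : {RV P >-> 'Rn[R]_n}) (f : {mfun 'Rn[R]_n >-> 'Rn[R]_k})
    (q : 'Rn[R]_k -> 'Rn[R]_m -> R) : \bar R :=
  \int[distribution P (pair_RV Y X)]_z lne (q (f z.2) z.1)%:E.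

Definition information_loss m n k (Y : {RV P >-> 'Rn[R]_m})
    (X : {RV P >-> 'Rn[R]_n}) (f : {mfun 'Rn[R]_n >-> 'Rn[R]_k}) : \bar R :=
  mutual_information Y X - mutual_information Y (f \o X : {mfun T >-> 'Rn[R]_k}).

(* Replacing h(Y | f(X)) by the cross-entropy - E[log q(Y | f(X))] in
   I(Y; X) - I(Y; f(X)) = I(Y; X) - h(Y) + h(Y | f(X)). *)
Definition information_loss_bound m n k (Y : {RV P >-> 'Rn[R]_m})
    (X : {RV P >-> 'Rn[R]_n}) (f : {mfun 'Rn[R]_n >-> 'Rn[R]_k})
    (q : 'Rn[R]_k -> 'Rn[R]_m -> R) : \bar R :=
  mutual_information Y X - differential_entropy Y
    - expected_log_surrogate Y X f q.

End information.

Section optimization.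
Context d (V : porderType d) (A : Type).

Definition is_argmax (D : set A) (g : A -> V) (a : A) : Prop :=
  D a /\ forall b, D b -> (g b <= g a)%O.

Definition is_argmin (D : set A) (g : A -> V) (a : A) : Prop :=
  D a /\ forall b, D b -> (g a <= g b)%O.

End optimization.

(* Main.v *)
(* Write Z = f(X).  The data-processing inequality and the bound
   E[log q(Y | Z)] <= I(Y; Z) - h(Y) are both Gibbs' inequality: if a measurable
   v >= 0 satisfies E[v / w] <= 1, then E[log v] <= E[log w].  For the first,
   w is the density of the law of (Y, X) with respect to the product of its
   marginals and v is the corresponding density for (Y, Z).  For the second,
   v = q and w is the density for (Y, Z) times the Lebesgue density of Y, and
   E[v / w] <= 1 because each q(. | t) has total mass 1.  The second also
   requires log w to be integrable: with g the density for (Y, Z), the negative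
   part of log g is at most 1/g, whose mean is at most 1, so I(Y; Z) > -oo.
   Finally, the bound is a finite constant minus the objective,
   so minimizing one is maximizing the other. *)
Require Import Defs.
From HB Require Import structures.
From mathcomp Require Import all_boot all_order all_algebra.
From mathcomp Require Import all_classical all_reals all_analysis.
From mathcomp Require Import measurable_realfun.

Set Implicit Arguments.
Unset Strict Implicit.
Unset Printing Implicit Defensive.

Import Order.TTheory GRing.Theory Num.Theory.

Local Open Scope classical_set_scope.
Local Open Scope ring_scope.
Local Open Scope ereal_scope.

(** * Integration of extended real functions, image laws and Gibbs' inequality *)

Section integral_extra.
Context d (T : measurableType d) (R : realType).
Variable mu : {measure set T -> \bar R}.

Lemma measurable_lne (f : T -> \bar R) : measurable_fun setT f ->
  measurable_fun setT (fun x => lne (f x)).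
Proof.
move=> mf.
have -> : (fun x => lne (f x)) = (fun x => if f x == +oo then +oo else
    if f x <= 0 then -oo else (ln (fine (f x)))%:E).
  apply/funext => x; case: (f x) => [r| |] //=.
  by rewrite leNye.
apply: measurable_fun_ifT => //.
  exact: measurable_fun_eqe.
apply: measurable_fun_ifT => //.
  exact: measurable_fun_lee.
by apply/measurable_EFinP; do 2 apply: measurableT_comp => //.
Qed.

(* Holds without integrability because [+oo - +oo = -oo] in [\bar R]. *)
Lemma le_integral_measurable (f g : T -> \bar R) :
  measurable_fun setT f -> measurable_fun setT g ->
  (forall x, f x <= g x) -> \int[mu]_x f x <= \int[mu]_x g x.
Proof.
move=> mf mg fg; rewrite integralE [leRHS]integralE leeB//.
- apply: ge0_le_integral => //; try exact: measurable_funepos.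
  by move=> x _; apply: (@funepos_le _ _ setT); rewrite ?inE// => y _.
- apply: ge0_le_integral => //; try exact: measurable_funeneg.
  by move=> x _; apply: (@funeneg_le _ _ setT); rewrite ?inE// => y _.
Qed.

(** The integral is the difference of those of [f^\+] and [f^\-], and in [\bar R] a difference with
    an infinite term is infinite. *)
Lemma fin_num_integrable (f : T -> \bar R) : measurable_fun setT f ->
  \int[mu]_x f x \is a fin_num -> mu.-integrable setT f.
Proof.
move=> mf; rewrite integralE => fin; apply/integrableP; split=> //.
rewrite (eq_integral (fun x => f^\+ x + f^\- x)); last first.
  by move=> x _; rewrite -[LHS]/((abse \o f) x) fune_abse.
have p0 : 0 <= \int[mu]_x f^\+ x by exact: integral_ge0.
have n0 : 0 <= \int[mu]_x f^\- x by exact: integral_ge0.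
rewrite ge0_integralD//; [|exact: measurable_funepos|exact: measurable_funeneg].
move: fin p0 n0; case: (\int[mu]_x f^\+ x) => [r| |]//;
  case: (\int[mu]_x f^\- x) => [s| |]// *; exact: ltry.
Qed.

(** From [1 + x <= expR x], the negative part of [l] is at most [expR (- l)]. Once that part has
    finite integral, the upper bound on the integral of [l] controls the positive part. *)
Lemma integrable_of_expRN (l : T -> R) : measurable_fun setT l ->
  \int[mu]_x (expR (- l x))%:E < +oo -> \int[mu]_x (l x)%:E < +oo ->
  mu.-integrable setT (EFin \o l).
Proof.
move=> ml el lfin.
have mEl : measurable_fun setT (EFin \o l) by exact/measurable_EFinP.
apply: fin_num_integrable => //.
have p0 : 0 <= \int[mu]_x (EFin \o l)^\+ x by exact: integral_ge0.
have n0 : 0 <= \int[mu]_x (EFin \o l)^\- x by exact: integral_ge0.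
have noo : \int[mu]_x (EFin \o l)^\- x < +oo.
  apply: le_lt_trans el; apply: ge0_le_integral => //.
  - exact: measurable_funeneg.
  - apply/measurable_EFinP; apply: measurableT_comp => //.
    exact: measurableT_comp.
  - move=> x _; rewrite funenegE /= -EFin_max lee_fin ge_max.
    rewrite expR_ge0 andbT (le_trans _ (expR_ge1Dx _))//.
    by rewrite lerDr.
move: lfin; rewrite [X in X < _]integralE [X in X \is a _]integralE.
move: p0 n0 noo; case: (\int[mu]_x _^\+ x) => [r| |]//;
  by case: (\int[mu]_x _^\- x) => [s| |].
Qed.

End integral_extra.

(** Positive and negative parts are transported separately, so that infinite integrals are covered,
    as for the logarithm of a vanishing surrogate. *)
Lemma integral_distributionE d d' (T : measurableType d)
    (T' : measurableType d') (R : realType) (P : probability T R)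
    (X : {RV P >-> T'}) (f : T' -> \bar R) : measurable_fun setT f ->
  \int[distribution P X]_y f y = \int[P]_x f (X x).
Proof.
move=> mf; rewrite [LHS]integralE [RHS]integralE.
rewrite (@ge0_integral_distribution _ _ _ _ _ _ _ f^\+); last 2 first.
- exact: measurable_funepos.
- by [].
rewrite (@ge0_integral_distribution _ _ _ _ _ _ _ f^\-); last 2 first.
- exact: measurable_funeneg.
- by [].
congr (_ - _); apply: eq_integral => x _.
  by rewrite /= !funeposE.
by rewrite /= !funenegE.
Qed.

Lemma integrable_distribution d d' (T : measurableType d)
    (T' : measurableType d') (R : realType) (P : probability T R)
    (X : {RV P >-> T'}) (f : T' -> \bar R) : measurable_fun setT f ->
  (distribution P X).-integrable setT f <-> P.-integrable setT (f \o X).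
Proof.
move=> mf; have mfX : measurable_fun setT (f \o X) by exact: measurableT_comp.
have E : \int[distribution P X]_y `|f y| = \int[P]_x `|f (X x)|.
  by rewrite integral_distributionE//; exact: measurableT_comp.
by split=> /integrableP[_ foo]; apply/integrableP; split=> //;
  move: foo; rewrite E.
Qed.

(* Integrate [log (v / w) <= v / w - 1], where [w = expR l]. *)
Lemma gibbs d (T : measurableType d) (R : realType) (mu : probability T R)
    (v l : T -> R) : measurable_fun setT v -> (forall x, (0 <= v x)%R) ->
  mu.-integrable setT (EFin \o l) ->
  \int[mu]_x (v x * expR (- l x))%:E <= 1 ->
  \int[mu]_x lne (v x)%:E <= \int[mu]_x (l x)%:E.
Proof.
move=> mv v0 il vl1.
have ml : measurable_fun setT l.
  by apply/measurable_EFinP; exact: measurable_int il.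
have mr : measurable_fun setT (fun x => v x * expR (- l x))%R.
  apply: measurable_funM => //; apply: measurableT_comp => //.
  exact: measurableT_comp.
have ir : mu.-integrable setT (fun x => (v x * expR (- l x))%:E).
  apply/integrableP; split; first exact/measurable_EFinP.
  under eq_integral => x _.
    rewrite gee0_abs; last by rewrite lee_fin mulr_ge0// expR_ge0.
    over.
  exact: le_lt_trans vl1 (ltry _).
have i1 : mu.-integrable setT (cst (1 : \bar R)).
  exact: finite_measure_integrable_cst.
have ir1 := integrableB measurableT ir i1.
have ilr := integrableD measurableT il ir1.
apply: (@le_trans _ _
  (\int[mu]_x ((l x)%:E + ((v x * expR (- l x))%:E - 1)))).
- apply: le_integral_measurable => [||x].
  + exact/measurable_lne/measurable_EFinP.
  + exact: measurable_int ilr.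
  have [v0x|] := ltP 0%R (v x); last first.
    by move=> vx0; rewrite le0_lneNy ?lee_fin// leNye.
  rewrite lne_EFin// -EFinN -!EFinD lee_fin -lerBlDl.
  (* This local [w] is the whole ratio [v x / expR (l x)]; the bound is [ln (1 + t) <= t] at
     [t = w - 1]. *)
  set w := (v x * _)%R; have w0 : (0 < w)%R by rewrite mulr_gt0// expR_gt0.
  have -> : (ln (v x) - l x = ln w)%R.
    by rewrite lnM ?posrE ?expR_gt0// expRK.
  have /le_ln1Dx : (-1 < w - 1)%R by rewrite ltrBrDl subrr.
  by rewrite addrCA subrr addr0.
- have mu1 : \int[mu]_x cst 1 x = 1 :> \bar R.
    by rewrite integral_cst// mul1e; exact: probability_setT.
  rewrite integralD// integralB// mu1 geeDl ?sube_le0//.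
Qed.

(** * Radon-Nikodym densities and their logarithms *)

Section log_density.
Context d (T : measurableType d) (R : realType).
Local Open Scope charge_scope.

(* Where [f] vanishes, which has [mu]-measure 0, the junk value [ln 0 = 0] makes
   the weight [expR (- ln (f x))] equal to 1; hence an inequality in the last
   clause instead of a change of variables. *)
Lemma log_density (mu : {finite_measure set T -> \bar R})
    (nu : {sigma_finite_measure set T -> \bar R}) : mu `<< nu ->
  exists f : T -> R,
    [/\ measurable_fun setT f, forall x, (0 <= f x)%R,
      \int[nu]_x (f x)%:E = mu setT,
      \int[mu]_x lne (('d (charge_of_finite_measure mu) '/d nu) x) =
        \int[mu]_x lne (f x)%:E /\
      \int[mu]_x lne (f x)%:E = \int[mu]_x (ln (f x))%:E &
      forall h : T -> R, measurable_fun setT h -> (forall x, 0 <= h x)%R ->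
        \int[mu]_x (h x * expR (- ln (f x)))%:E <= \int[nu]_x (h x)%:E].
Proof.
move=> munu.
pose F := Radon_Nikodym_SigmaFinite.f mu nu.
have F0 x : 0 <= F x by exact: Radon_Nikodym_SigmaFinite.f_ge0.
have Ffin x : F x \is a fin_num by exact: Radon_Nikodym_SigmaFinite.f_fin_num.
have mF : measurable_fun setT F.
  exact: measurable_int (Radon_Nikodym_SigmaFinite.f_integrable munu).
have FE x : (fine (F x))%:E = F x by rewrite fineK.
have mfF : measurable_fun setT (fine \o F) by exact: measurableT_comp.
exists (fine \o F); split => //.
- by move=> x; exact: fine_ge0.
- under eq_integral do rewrite /= FE.
  by rewrite -Radon_Nikodym_SigmaFinite.f_integral.
(* The two versions of the density agree [nu]-almost everywhere, hence [mu]-almost everywhere by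
   domination. *)
- have RNE : {ae mu, forall x,
      F x = ('d (charge_of_finite_measure mu) '/d nu) x}.
    have := ae_eq_Radon_Nikodym_SigmaFinite munu measurableT.
    move=> [N [mN N0 sN]]; exists N; split=> //.
      by have /null_content_dominatesP := munu; apply.
    by apply: subset_trans sN => x /=; apply: contra_not; apply.
  have mN : measurable (F @^-1` [set 0]).
    by rewrite -[X in measurable X]setTI; apply: mF.
  (* The [mu]-mass of the zero set of [F] is the [nu]-integral of [F] over it. Off this set [lne]
     and [ln] agree. *)
  have F00 : {ae mu, forall x, F x != 0}.
    exists (F @^-1` [set 0]); split => //=.
      rewrite (Radon_Nikodym_SigmaFinite.f_integral munu)//.
      by rewrite integral0_eq.
    by move=> x /= /negP; rewrite negbK => /eqP.
  have mRN : measurable_fun setT ('d (charge_of_finite_measure mu) '/d nu).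
    by apply: measurable_int; exact: Radon_Nikodym_integrable.
  have mEF : measurable_fun setT (fun x => ((fine \o F) x)%:E).
    exact/measurable_EFinP.
  split; apply: ae_eq_integral => //; try exact: measurable_lne.
  + move: RNE; apply: filterS => x Fx _.
    by rewrite -Fx [((fine \o F) x)%:E]FE.
  + by apply/measurable_EFinP; exact: measurableT_comp.
  + move: F00; apply: filterS => x Fx0 _.
    by rewrite lne_EFin// fine_gt0// lt0e Fx0 F0/= ltey_eq Ffin.
- move=> h mh h0.
  have me : measurable_fun setT (fun x => (h x * expR (- ln (fine (F x))))%:E).
    apply/measurable_EFinP; apply: measurable_funM => //.
    by do 3 apply: measurableT_comp => //.
  have he0 x : 0 <= (h x * expR (- ln (fine (F x))))%:E.
    by rewrite lee_fin mulr_ge0// expR_ge0.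
  rewrite -(Radon_Nikodym_SigmaFinite.change_of_variables munu)//.
  apply: ge0_le_integral => //.
  + by move=> x _; rewrite mule_ge0.
  + exact: emeasurable_funM.
  + exact/measurable_EFinP.
  (* The weight times [F x] is 1 where [F x > 0] and 0 where [F x = 0]. *)
  + move=> x _; rewrite -/F -[F x]FE -EFinM lee_fin -mulrA ler_piMr//.
    have := F0 x; rewrite le_eqVlt => /predU1P[<-|Fx0]; first by rewrite mulr0.
    have fx0 : (0 < fine (F x))%R by rewrite fine_gt0// Fx0/= ltey_eq Ffin.
    by rewrite expRN lnK ?posrE// mulVf// gt_eqF.
Qed.

End log_density.

(** * Kullback-Leibler divergence and data processing *)

Section kl_divergence.
Context d (T : measurableType d) (R : realType).
Variables mu nu : probability T R.

Lemma kl_divergence_fin_num_dominates :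
  kl_divergence mu nu \is a fin_num -> mu `<< nu.
Proof. by rewrite /kl_divergence; case: asboolP. Qed.

Lemma kl_divergence_density : mu `<< nu ->
  exists g : T -> R,
    [/\ measurable_fun setT g, forall z, (0 <= g z)%R,
      \int[nu]_z (g z)%:E = 1,
      kl_divergence mu nu = \int[mu]_z lne (g z)%:E /\
      kl_divergence mu nu = \int[mu]_z (ln (g z))%:E &
      forall h : T -> R, measurable_fun setT h -> (forall z, 0 <= h z)%R ->
        \int[mu]_z (h z * expR (- ln (g z)))%:E <= \int[nu]_z (h z)%:E].
Proof.
move=> dom.
have [g [mg g0 g1 [E1 E2] gh]] := log_density dom.
exists g; split => //; first by rewrite g1; exact: probability_setT.
by rewrite /kl_divergence asboolT//; split; rewrite E1.
Qed.

End kl_divergence.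

(** Gibbs' inequality under [mu] with [v = g' \o S] and [l = ln g]: the mean of [v / g] is at most
    the [nu]-integral of [g' \o S], which is the [nu']-integral of [g'], namely 1. Describing [mu']
    and [nu'] by their values lets [nu'] be a product measure. *)
Lemma kl_data_processing d d' (T : measurableType d) (T' : measurableType d')
    (R : realType) (mu nu : probability T R) (mu' nu' : probability T' R)
    (S : {mfun T >-> T'}) :
  (forall A, measurable A -> mu' A = distribution mu S A) ->
  (forall A, measurable A -> nu' A = distribution nu S A) ->
  kl_divergence mu nu \is a fin_num ->
  mu' `<< nu' /\ kl_divergence mu' nu' <= kl_divergence mu nu.
Proof.
move=> muS nuS fin; have dom := kl_divergence_fin_num_dominates fin.
have dom' : mu' `<< nu'.
  apply/null_content_dominatesP => A mA A0.
  apply: etrans (muS _ mA) _.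
  have /null_content_dominatesP := dom; apply; last first.
    exact: etrans (esym (nuS _ mA)) A0.
  by rewrite -[X in measurable X]setTI; exact: measurable_funP.
split=> //.
have [g [mg g0 _ [_ klE] gh]] := kl_divergence_density dom.
have [g' [mg' g0' g1' [klE' _] _]] := kl_divergence_density dom'.
have mgS : measurable_fun setT (g' \o S) by exact: measurableT_comp.
have -> : kl_divergence mu' nu' = \int[mu]_x lne ((g' \o S) x)%:E.
  rewrite klE' (eq_measure_integral (distribution mu S)); last first.
    by move=> A mA _; exact: muS.
  by rewrite integral_distributionE//; apply/measurable_lne/measurable_EFinP.
rewrite [leRHS]klE; apply: gibbs => //.
- by move=> x; exact: g0'.
- apply: fin_num_integrable; last by rewrite -[X in X \is a _]klE.
  by apply/measurable_EFinP; exact: measurableT_comp.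
- apply: le_trans (gh _ mgS (fun x => g0' (S x))) _.
  rewrite -g1' (eq_measure_integral (distribution nu S)); last first.
    by move=> A mA _; exact: nuS.
  by rewrite integral_distributionE//; exact/measurable_EFinP.
Qed.

Section on_snd.
Context d1 d2 d3 (T1 : measurableType d1) (T2 : measurableType d2)
  (T3 : measurableType d3) (f : {mfun T2 >-> T3}).

Definition on_snd (z : T1 * T2) : T1 * T3 := (z.1, f z.2).

Lemma measurable_on_snd : measurable_fun [set: T1 * T2] on_snd.
Proof.
apply: measurable_fun_pair; first exact: measurable_fst.
exact (measurableT_comp (@measurable_funPT _ _ _ _ f) measurable_snd).
Qed.

HB.instance Definition _ :=
  isMeasurableFun.Build _ _ _ _ on_snd measurable_on_snd.

End on_snd.

(** The map [on_snd f] carries the joint law to the joint law and the product of marginals to the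
    product of marginals, both by computation. *)
Lemma data_processing d d1 d2 d3 (T : measurableType d)
    (T1 : measurableType d1) (T2 : measurableType d2)
    (T3 : measurableType d3) (R : realType) (P : probability T R)
    (Y : {RV P >-> T1}) (X : {RV P >-> T2}) (f : {mfun T2 >-> T3}) :
  mutual_information Y X \is a fin_num ->
  distribution P (pair_RV Y (f \o X : {mfun T >-> T3})) `<<
    distribution P Y \x distribution P (f \o X : {mfun T >-> T3}) /\
  mutual_information Y (f \o X : {mfun T >-> T3}) <= mutual_information Y X.
Proof.
apply: (@kl_data_processing _ _ _ _ _ (distribution P (pair_RV Y X))
  (distribution P Y \x distribution P X)
  (distribution P (pair_RV Y (f \o X : {mfun T >-> T3})))
  (distribution P Y \x distribution P (f \o X : {mfun T >-> T3}))
  (on_snd f)) => //.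
Qed.

(** * The surrogate bound *)

Section surrogate.
Local Open Scope charge_scope.

(** Here [- entY] is the entropy h(Y) relative to [lam], so the bound reads I(Y; U) - h(Y). *)
Lemma mutual_information_surrogate d d1 d2 (T : measurableType d)
    (T1 : measurableType d1) (T2 : measurableType d2) (R : realType)
    (P : probability T R) (Y : {RV P >-> T1}) (U : {RV P >-> T2})
    (lam : {sigma_finite_measure set T1 -> \bar R}) (q : T2 -> T1 -> R)
    (entY := \int[distribution P Y]_y
      lne (('d (charge_of_finite_measure (distribution P Y)) '/d lam) y)) :
  distribution P (pair_RV Y U) `<< distribution P Y \x distribution P U ->
  distribution P Y `<< lam ->
  mutual_information Y U < +oo -> entY \is a fin_num ->
  measurable_fun setT (fun z : T2 * T1 => q z.1 z.2) ->
  (forall t y, (0 <= q t y)%R) -> (forall t, \int[lam]_y (q t y)%:E = 1) ->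
  mutual_information Y U \is a fin_num /\
  \int[distribution P (pair_RV Y U)]_z lne (q z.2 z.1)%:E <=
    mutual_information Y U + entY.
Proof.
move=> dom domY Ioo hY mq q0 q1.
have [g [mg g0 g1 [_ IE] gh]] := @kl_divergence_density _ _ _
  (distribution P (pair_RV Y U)) (distribution P Y \x distribution P U) dom.
rewrite -/(mutual_information Y U) in IE.
have [p [mp p0 _ [pE pE'] ph]] := log_density domY.
have {pE pE'}entE : entY = \int[distribution P Y]_y (ln (p y))%:E.
  by rewrite -pE'.
have mlp : measurable_fun setT (fun y => ln (p y)) by exact: measurableT_comp.
have mlp1 : measurable_fun setT (fun z : T1 * T2 => ln (p z.1)).
  exact: (measurableT_comp mlp measurable_fst).
have mlg : measurable_fun setT (fun z => ln (g z)) by exact: measurableT_comp.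
have mq' : measurable_fun setT (fun z : T1 * T2 => q z.2 z.1).
  exact (measurableT_comp mq (@measurable_swap _ _ T1 T2)).
have ilp : (distribution P (pair_RV Y U)).-integrable setT
    (EFin \o (fun z => ln (p z.1))).
  have : (distribution P Y).-integrable setT (EFin \o (fun y => ln (p y))).
    apply: fin_num_integrable; first exact/measurable_EFinP.
    by rewrite -[X in X \is a _]entE.
  move/integrable_distribution => /(_ (iffRL (measurable_EFinP _ _) mlp)) i.
  by apply/integrable_distribution => //; exact/measurable_EFinP.
have ilg : (distribution P (pair_RV Y U)).-integrable setT
    (EFin \o (fun z => ln (g z))).
  (* Taking [h = 1] in [gh] bounds the mean of [1 / g] by 1. *)
  apply: integrable_of_expRN => //; last by rewrite -IE.
  under eq_integral => z _ do rewrite -[expR _]mul1r.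
  apply: le_lt_trans (gh (cst 1%R) (measurable_cst _) (fun _ => ler01)) _.
  rewrite -[X in X < _]/(\int[_]_z cst 1%E z) integral_cst// mul1e.
  by apply: le_lt_trans (ltry 1); exact: probability_le1.
have If : mutual_information Y U \is a fin_num.
  by rewrite IE; exact: integrable_fin_num ilg.
split => //.
pose l z := (ln (g z) + ln (p z.1))%R.
have -> : mutual_information Y U + entY =
    \int[distribution P (pair_RV Y U)]_z (l z)%:E.
  rewrite /l; under eq_integral do rewrite EFinD.
  rewrite integralD// IE entE; congr (_ + _).
  rewrite integral_distributionE; last exact/measurable_EFinP.
  by rewrite integral_distributionE//; exact/measurable_EFinP.
apply: gibbs => //.
  have -> : EFin \o l = (EFin \o (fun z => ln (g z))) \+
      (EFin \o (fun z => ln (p z.1))) by apply/funext => z.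
  exact: integrableD.
pose h z := (q z.2 z.1 * expR (- ln (p z.1)))%R.
have mh : measurable_fun setT h.
  apply: measurable_funM => //; apply: measurableT_comp => //.
  exact: measurableT_comp.
have h0 z : (0 <= h z)%R by rewrite mulr_ge0// expR_ge0.
rewrite (eq_integral (fun z => (h z * expR (- ln (g z)))%:E)); last first.
  by move=> z _; rewrite /h /l opprD expRD mulrA mulrAC.
(* The factors of [q / (g p)] are removed in turn: [gh] passes from the joint law to the product of
   marginals, then, for fixed [t], [ph] passes from the law of [Y] to [lam], where [q t] has mass
   1. *)
apply: le_trans (gh _ mh h0) _.
rewrite fubini_tonelli2//; last exact/measurable_EFinP.
rewrite -(probability_setT (distribution P U)) -[leRHS]mul1e -integral_cst//.
apply: ge0_le_integral => //.
- by move=> t _; apply: integral_ge0 => y _; rewrite lee_fin.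
- apply: measurable_fun_fubini_tonelli_G => //; exact/measurable_EFinP.
- move=> t _; rewrite /fubini_G /= -(q1 t) /h /=.
  apply: (ph (q t)) => //.
  exact (measurableT_comp mq (pair1_measurable t)).
Qed.

End surrogate.

(** * Absolute continuity of the law of Y, and the optimization statement *)

Lemma jointly_continuous_dominates d (T : measurableType d) (R : realType)
    (P : probability T R) m n (Y : {RV P >-> 'Rn[R]_m})
    (X : {RV P >-> 'Rn[R]_n}) :
  jointly_continuous Y X -> distribution P Y `<< lebesgueRn R m.
Proof.
move=> [p [mp p0 pE]]; apply/null_content_dominatesP => A mA A0.
transitivity (distribution P (pair_RV Y X) (A `*` setT)).
  by congr (P _); apply/seteqP; split => // w [].
(* [A] times the whole space is null for the product measure, thanks to [0 * +oo = 0]. *)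
rewrite pE; last exact: measurableX.
apply: null_set_integral.
- exact: measurableX.
- by apply: measurable_funTS; exact/measurable_EFinP.
- apply: etrans (product_measure1E _ _ mA measurableT) _.
  by rewrite [X in X * _]A0 mul0e.
Qed.

(** For finite [c], the map [x |-> c - x] reverses the order on all of [\bar R], so [g] may take
    infinite values. *)
Lemma is_argmax_argmin (A : Type) (R : realType) (D : set A)
    (g : A -> \bar R) (c : \bar R) a : c \is a fin_num ->
  is_argmax D g a <-> is_argmin D (fun b => c - g b) a.
Proof.
move=> cfin; have E x y : (c - x <= c - y) = (y <= x).
  by rewrite leeD2lE// leeN2.
by split=> -[Da opt]; split=> // b /opt; rewrite E.
Qed.

Theorem theorem1 (R : realType) (d : measure_display) (T : measurableType d)
    (P : probability T R) (m n k : nat)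
    (Y : {RV P >-> 'Rn[R]_m}) (X : {RV P >-> 'Rn[R]_n})
    (F : set {mfun 'Rn[R]_n >-> 'Rn[R]_k})
    (Theta : Type) (q : Theta -> 'Rn[R]_k -> 'Rn[R]_m -> R)
    (hYX : jointly_continuous Y X)
    (hI : mutual_information Y X \is a fin_num)
    (hY : differential_entropy Y \is a fin_num)
    (hq : forall theta, is_conditional_density (q theta)) :
  (forall f theta, F f ->
     0 <= information_loss Y X f <= information_loss_bound Y X f (q theta)) /\
  (forall a : {mfun 'Rn[R]_n >-> 'Rn[R]_k} * Theta,
     is_argmax (F `*` [set: Theta])
       (fun b => expected_log_surrogate Y X b.1 (q b.2)) a <->
     is_argmin (F `*` [set: Theta])
       (fun b => information_loss_bound Y X b.1 (q b.2)) a).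
Proof.
split=> [f theta _|a]; last first.
  by apply: is_argmax_argmin; rewrite fin_numB hI hY.
have [dom Ile] := data_processing f hI.
have [mq q0 q1] := hq theta.
have hE : \int[distribution P Y]_y lne (density Y y) \is a fin_num.
  by rewrite -fin_numN.
have Ioo : mutual_information Y X < +oo by rewrite ltey_eq hI.
have [Ifin Eq] := mutual_information_surrogate dom
  (jointly_continuous_dominates hYX) (le_lt_trans Ile Ioo) hE mq q0 q1.
rewrite /information_loss sube_ge0 ?Ifin//; rewrite Ile /=.
rewrite /information_loss_bound -addeA leeD2lE//.
have mlq : measurable_fun setT
    (fun z : 'Rn[R]_m * 'Rn[R]_k => lne (q theta z.2 z.1)%:E).
  apply/measurable_lne/measurable_EFinP.
  exact (measurableT_comp mq (@measurable_swap _ _ _ _)).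
(* The objective sees X only through f(X), so it is an integral over the law of (Y, f(X)), as in
   [Eq]. *)
have -> : expected_log_surrogate Y X f (q theta) =
    \int[distribution P (pair_RV Y (f \o X : {mfun T >-> 'Rn[R]_k}))]_z
      lne (q theta z.2 z.1)%:E.
  rewrite (integral_distributionE _ mlq) /expected_log_surrogate.
  rewrite (@integral_distributionE _ _ _ _ _ _ _
    (fun z : 'Rn[R]_m * 'Rn[R]_n => lne (q theta (f z.2) z.1)%:E))//.
  exact (measurableT_comp mlq (measurable_on_snd f)).
rewrite /differential_entropy oppeK.
apply: le_trans (leeB (lexx _) Eq).
by rewrite fin_num_oppeD// addeCA subee// adde0.
Qed.
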